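(* Let $W\in\mathbb{R}^{n\times n}$ be symmetric positive definite, let $T\in\mathbb{R}^{n\times n}$ be symmetric positive semidefinite, and let $\alpha>0$. Let $(\lambda_k,u_k)$, $u_k=(x_k;y_k)$, be the eigenpairs of $\mathcal{G}_\alpha^{-1}\mathcal{A}$, with associated numbers $a_k,b_k,c_k$ (matrices, eigenpairs and numbers as defined in the context). Suppose $$0<\alpha\le \min\left\{\frac{2}{b_k}\left(\sqrt{a_k(a_k+c_k)}-a_k\right):\ b_k\neq 0\right\},$$ the minimum being over those eigenpairs with $y_k\ne 0$ and $b_k\neq 0$. Then the eigenvalues of $\mathcal{G}_\alpha^{-1}\mathcal{A}$ are enclosed in a circle of radius $\sqrt{(c_k-\alpha b_k)/a_k}$ centered at $(1,0)$; that is, for every $k$, $$|\lambda_k-1|\le \sqrt{\frac{c_k-\alpha b_k}{a_k}},$$ where the right-hand side is read as $0$ (i.e. $\lambda_k=1$) if $y_k=0$ or $a_k=0$.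
   Context: For $W,T\in\mathbb{R}^{n\times n}$ and $\alpha>0$ define the $2n\times 2n$ real block matrices $$\mathcal{A}=\begin{bmatrix} W & -T\\ T & W\end{bmatrix},\qquad \mathcal{G}_\alpha=\begin{bmatrix} W & 0\\ \alpha I & W\end{bmatrix},$$ where $I$ is the $n\times n$ identity. Eigenvalues and eigenvectors are taken over $\mathbb{C}$. The eigenpairs $(\lambda_k,u_k)$ of $\mathcal{G}_\alpha^{-1}\mathcal{A}$ form a finite list in which every eigenvalue occurs with at least one eigenvector $u_k=(x_k;y_k)\neq 0$, $x_k,y_k\in\mathbb{C}^n$ (the vector obtained by stacking $x_k$ on top of $y_k$). For each $k$ with $y_k\ne0$ set $$a_k=\frac{y_k^{*}Ty_k}{y_k^*y_k},\quad b_k=\frac{y_k^{*}TW^{-2}Ty_k}{y_k^*y_k},\quad c_k=\frac{y_k^{*}TW^{-1}TW^{-1}Ty_k}{y_k^*y_k},$$ where $*$ denotes conjugate transpose; these are nonnegative real numbers. If no eigenpair has $y_k\neq0$ and $b_k\ne 0$, the upper bound on $\alpha$ is void. *)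

(* Defs.v *)
From HB Require Import structures.
From mathcomp Require Import all_boot all_order all_algebra.
From mathcomp Require Import reals complex.
Set Implicit Arguments.
Unset Strict Implicit.
Unset Printing Implicit Defensive.
Import Order.TTheory GRing.Theory Num.Theory.
Local Open Scope ring_scope.
Local Open Scope complex_scope.
Local Open Scope sesquilinear_scope.

Definition posdefmx (R : realType) (n : nat) (M : 'M[R]_n) : Prop :=
  M \is symmetricmx /\ forall v : 'cV[R]_n, v != 0 -> 0 < (v^T *m M *m v) 0 0.

Definition possemidefmx (R : realType) (n : nat) (M : 'M[R]_n) : Prop :=
  M \is symmetricmx /\ forall v : 'cV[R]_n, 0 <= (v^T *m M *m v) 0 0.

Definition complexmx (R : realType) (m n : nat) (M : 'M[R]_(m, n)) :
  'M[R[i]]_(m, n) := map_mx (real_complex R) M.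

Definition Amx (R : realType) (n : nat) (W T : 'M[R]_n) : 'M[R]_(n + n) :=
  block_mx W (- T) T W.

Definition Gmx (R : realType) (n : nat) (alpha : R) (W : 'M[R]_n) :
  'M[R]_(n + n) := block_mx W 0 alpha%:M W.

(* [Gmx alpha W] is invertible as soon as [W] is, e.g. for [posdefmx W], so
   [invmx] is then the actual inverse. *)
Definition precmx (R : realType) (n : nat) (alpha : R) (W T : 'M[R]_n) :
  'M[R]_(n + n) := invmx (Gmx alpha W) *m Amx W T.

(* [eigenvalue] and [eigenspace] act on row vectors; here the eigenvectors are
   column vectors. *)
Definition eigenpair (R : realType) (n : nat) (M : 'M[R]_n)
    (l : R[i]) (u : 'cV[R[i]]_n) : Prop :=
  u != 0 /\ complexmx M *m u = l *: u.

Definition hquot (R : realType) (n : nat) (H : 'M[R]_n) (y : 'cV[R[i]]_n) :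
  R[i] := (y^t* *m complexmx H *m y) 0 0 / (y^t* *m y) 0 0.

(* For symmetric [H] the quotient is real ([rquotE] below), so taking the real
   part discards nothing. *)
Definition rquot (R : realType) (n : nat) (H : 'M[R]_n) (y : 'cV[R[i]]_n) : R :=
  complex.Re (hquot H y).

Definition coef_a (R : realType) (n : nat) (T : 'M[R]_n)
  (y : 'cV[R[i]]_n) : R := rquot T y.

Definition coef_b (R : realType) (n : nat) (W T : 'M[R]_n)
  (y : 'cV[R[i]]_n) : R := rquot (T *m (invmx W *m invmx W) *m T) y.

Definition coef_c (R : realType) (n : nat) (W T : 'M[R]_n)
  (y : 'cV[R[i]]_n) : R := rquot (T *m invmx W *m T *m invmx W *m T) y.

Definition radius (R : realType) (n : nat) (alpha : R) (W T : 'M[R]_n)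
    (y : 'cV[R[i]]_n) : R :=
  if (y == 0) || (coef_a T y == 0) then 0
  else Num.sqrt ((coef_c W T y - alpha * coef_b W T y) / coef_a T y).

Lemma sym_trmx (R : realType) (n : nat) (H : 'M[R]_n) :
  H \is symmetricmx -> H^T = H.
Proof. by move=> /is_hermitianmxP; rewrite expr0 scale1r map_mx_id. Qed.

Lemma rquotE (R : realType) (n : nat) (H : 'M[R]_n) (y : 'cV[R[i]]_n) :
  H^T = H -> (rquot H y)%:C = hquot H y.
Proof.
move=> sH.
have hreal (B : 'M[R]_n) : B^T = B ->
    (y^t* *m complexmx B *m y) 0 0 \is Num.real.
  move=> sB; apply/CrealP.
  set S := _ *m _ *m y.
  have {2}-> : S = S^t*.
    rewrite /S !trmx_mul !map_mxM /= map_trmx trmxK -map_mx_comp.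
    rewrite (_ : map_mx _ y = y); last by apply/matrixP => i j; rewrite mxE /= conjCK.
    rewrite -mulmxA; congr (_ *m (_ *m _)); apply/matrixP => i j.
    rewrite !mxE conj_Creal; first by rewrite -{1}sB mxE.
    by apply/complex_realP; exists (B j i).
  by rewrite !mxE.
have : hquot H y \is Num.real.
  rewrite /hquot rpred_div ?hreal //.
  have := hreal 1%:M (trmx1 _ _).
  by rewrite /complexmx map_mx1 mulmx1.
by move=> /complex_realP[x hx]; rewrite /rquot hx.
Qed.

Lemma coef_abc_real (R : realType) (n : nat) (W T : 'M[R]_n)
    (y : 'cV[R[i]]_n) : W \is symmetricmx -> T \is symmetricmx ->
  [/\ (coef_a T y)%:C = hquot T y,
      (coef_b W T y)%:C = hquot (T *m (invmx W *m invmx W) *m T) y &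
      (coef_c W T y)%:C = hquot (T *m invmx W *m T *m invmx W *m T) y].
Proof.
move=> /sym_trmx sW /sym_trmx sT.
by split; apply: rquotE; rewrite ?trmx_mul ?trmx_inv ?sW ?sT ?mulmxA.
Qed.

(* Main.v *)
(* With mu = lambda - 1 the eigenvalue equation reads
     - T y = mu W x,   T x - alpha (1 + mu) x = mu W y.
   Eliminating x and pairing with W^-1 T y gives the real quadratic
     a mu^2 - alpha b mu + (c - alpha b) = 0.
   The bound on alpha says exactly that its discriminant
   (alpha b + 2 a)^2 - 4 a (a + c) is nonpositive, so its roots are conjugate
   (or equal), and the squared modulus of mu is the product of the roots,
   (c - alpha b) / a. *)
Require Import Defs.
From HB Require Import structures.
From mathcomp Require Import all_boot all_order all_algebra.
From mathcomp Require Import reals complex.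
From mathcomp Require Import ring lra.
Set Implicit Arguments.
Unset Strict Implicit.
Unset Printing Implicit Defensive.
Import Order.TTheory GRing.Theory Num.Theory.
Local Open Scope ring_scope.
Local Open Scope complex_scope.
Local Open Scope sesquilinear_scope.

(** * Complex vectors and Hermitian forms split into real and imaginary parts *)

Lemma complexmx_ReIm (R : realType) (m n : nat) (M : 'M[R[i]]_(m, n)) :
  M = complexmx (map_mx (@complex.Re R) M)
      + 'i *: complexmx (map_mx (@complex.Im R) M).
Proof. by apply/matrixP => i j; rewrite !mxE -complexE. Qed.

Lemma trmxC_ReIm (R : realType) (m n : nat) (M : 'M[R[i]]_(m, n)) :
  M^t* = complexmx (map_mx (@complex.Re R) M)^T
         - 'i *: complexmx (map_mx (@complex.Im R) M)^T.
Proof.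
apply/matrixP => i j; rewrite !mxE; case: (M j i) => a b /=.
by apply/eqP; rewrite eq_complex /=; apply/andP; split; apply/eqP; ring.
Qed.

(** For [y = p + 'i q] the cross terms are ['i] times the difference of [p^T H q] and [q^T H p],
    which cancel by symmetry. Real semidefiniteness thus becomes usable on complex eigenvectors. *)
Lemma form_ReIm (R : realType) (n : nat) (H : 'M[R]_n) (y : 'cV[R[i]]_n)
    (p := map_mx (@complex.Re R) y) (q := map_mx (@complex.Im R) y) :
  H^T = H ->
  (y^t* *m complexmx H *m y) 0 0
    = ((p^T *m H *m p) 0 0 + (q^T *m H *m q) 0 0)%:C.
Proof.
move=> sH.
have cross : (q^T *m H *m p) 0 0 = (p^T *m H *m q) 0 0.
  have -> : q^T *m H *m p = (p^T *m H *m q)^T.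
    by rewrite !trmx_mul trmxK sH mulmxA.
  by rewrite mxE.
rewrite trmxC_ReIm -/p -/q (complexmx_ReIm y) -/p -/q.
rewrite !mulmxBl !mulmxDr -!scalemxAl -!scalemxAr scalerA /complexmx -!map_mxM.
move: cross; move: (_ *m p) (_ *m p) (_ *m q) (_ *m q) => pp qp pq qq cross.
rewrite !mxE cross.
by apply/eqP; rewrite eq_complex /=; apply/andP; split; apply/eqP; ring.
Qed.

Lemma complex_mulmx_eq0 (R : realType) (m n : nat) (M : 'M[R]_(m, n))
    (y : 'cV[R[i]]_n) :
  complexmx M *m y = 0 <->
  M *m map_mx (@complex.Re R) y = 0 /\ M *m map_mx (@complex.Im R) y = 0.
Proof.
rewrite {1}(complexmx_ReIm y) mulmxDr -scalemxAr /complexmx -!map_mxM.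
split=> [/matrixP h | [-> ->]]; last by rewrite !map_mx0 scaler0 addr0.
split; apply/matrixP => i j; move: (h i j); rewrite !mxE => /eqP;
  rewrite eq_complex /= => /andP[/eqP hr /eqP hi]; lra.
Qed.

(** * Kernels of semidefinite matrices and signs of Rayleigh quotients *)

Lemma form1E (R : realType) (n : nat) (v : 'cV[R]_n) :
  (v^T *m v) 0 0 = \sum_i v i 0 ^+ 2.
Proof. by rewrite mxE; apply: eq_bigr => i _; rewrite mxE expr2. Qed.

Lemma form1_ge0 (R : realType) (n : nat) (v : 'cV[R]_n) : 0 <= (v^T *m v) 0 0.
Proof. by rewrite form1E; apply: sumr_ge0 => i _; exact: sqr_ge0. Qed.

Lemma form1_eq0 (R : realType) (n : nat) (v : 'cV[R]_n) :
  (v^T *m v) 0 0 = 0 -> v = 0.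
Proof.
rewrite form1E => /psumr_eq0P h; apply/matrixP => i j; rewrite ord1 mxE.
by apply/eqP; rewrite -sqrf_eq0 h // => k _; exact: sqr_ge0.
Qed.

(** A zero of the form is a minimum, so its first variation vanishes. Along [w = T v] that variation
    is twice the squared norm of [T v]. *)
Lemma possemidefmx_ker (R : realType) (n : nat) (T : 'M[R]_n) (v : 'cV[R]_n) :
  possemidefmx T -> (v^T *m T *m v) 0 0 = 0 -> T *m v = 0.
Proof.
move=> [/sym_trmx sT psdT] hv; apply: form1_eq0.
set w := T *m v; set P := (w^T *m w) 0 0; set Q := (w^T *m T *m w) 0 0.
have P_ge0 : 0 <= P := form1_ge0 w.
have Q_ge0 : 0 <= Q := psdT w.
have vTw : v^T *m T *m w = w^T *m w by rewrite [w^T]trmx_mul sT.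
have wTv : w^T *m T *m v = w^T *m w by rewrite -mulmxA.
have expand t : 0 <= 2 * t * P + t ^+ 2 * Q.
  have := psdT (v + t *: w).
  rewrite [(v + _)^T]linearD /= [(t *: w)^T]linearZ /=.
  rewrite !mulmxDl !mulmxDr -!scalemxAl -!scalemxAr vTw wTv.
  move: hv; rewrite /P /Q.
  move: (v^T *m T *m v) (w^T *m w) (w^T *m T *m w) => A B C hA.
  by rewrite !mxE hA; lra.
apply/eqP/negPn/negP => P_neq0.
have P_gt0 : 0 < P by rewrite lt_def P_neq0.
have Q1_gt0 : 0 < Q + 1 by lra.
(* A small negative [t] makes the linear term win. The denominator is [Q + 1] because [Q] may be
   0. *)
have := expand (- (P / (Q + 1))).
have -> : 2 * - (P / (Q + 1)) * P + (- (P / (Q + 1))) ^+ 2 * Q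
    = - (P / (Q + 1)) ^+ 2 * (Q + 2) by field; exact: lt0r_neq0.
rewrite leNgt mulNr oppr_lt0 mulr_gt0 ?exprn_gt0 ?divr_gt0 //; lra.
Qed.

Lemma posdefmx_unit (R : realType) (n : nat) (W : 'M[R]_n) :
  posdefmx W -> W \in unitmx.
Proof.
move=> [_ pW]; rewrite unitmxE unitfE; apply/negP => /det0P[v v0 vW].
have := pW v^T; rewrite trmxK vW mul0mx mxE ltxx trmx_eq0.
by move/(_ v0).
Qed.

Lemma rquot_ReIm (R : realType) (n : nat) (H : 'M[R]_n) (y : 'cV[R[i]]_n)
    (p := map_mx (@complex.Re R) y) (q := map_mx (@complex.Im R) y) :
  H^T = H ->
  rquot H y = ((p^T *m H *m p) 0 0 + (q^T *m H *m q) 0 0)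
              / ((p^T *m p) 0 0 + (q^T *m q) 0 0).
Proof.
move=> sH; rewrite /rquot /hquot form_ReIm //.
have := form_ReIm y (trmx1 R n).
rewrite /complexmx map_mx1 !mulmx1 => ->.
by rewrite -fmorphV -rmorphM.
Qed.

Lemma normsq_gt0 (R : realType) (n : nat) (y : 'cV[R[i]]_n)
    (p := map_mx (@complex.Re R) y) (q := map_mx (@complex.Im R) y) :
  y != 0 -> 0 < (p^T *m p) 0 0 + (q^T *m q) 0 0.
Proof.
move=> y0; have P := form1_ge0 p; have Q := form1_ge0 q.
rewrite lt_def addr_ge0 // andbT; apply: contraNneq y0 => PQ.
have p0 : p = 0 by apply: form1_eq0; lra.
have q0 : q = 0 by apply: form1_eq0; lra.
by rewrite (complexmx_ReIm y) -/p -/q p0 q0 /complexmx !map_mx0 scaler0 addr0.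
Qed.

Lemma rquot_ge0 (R : realType) (n : nat) (H : 'M[R]_n) (y : 'cV[R[i]]_n) :
  possemidefmx H -> 0 <= rquot H y.
Proof.
move=> [/sym_trmx sH psdH].
by rewrite rquot_ReIm // divr_ge0 ?addr_ge0 ?psdH ?form1_ge0.
Qed.

(** The numerator is a sum of two nonnegative real forms, so both vanish and the real kernel lemma
    applies to each part of [y]. *)
Lemma rquot_ker (R : realType) (n : nat) (H : 'M[R]_n) (y : 'cV[R[i]]_n) :
  possemidefmx H -> y != 0 -> rquot H y = 0 -> complexmx H *m y = 0.
Proof.
move=> psdH y0; have [/sym_trmx sH H_ge0] := psdH.
set p := map_mx (@complex.Re R) y; set q := map_mx (@complex.Im R) y.
have P := H_ge0 p; have Q := H_ge0 q.
rewrite rquot_ReIm // -/p -/q => /eqP; rewrite mulf_eq0 invr_eq0.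
rewrite (gt_eqF (normsq_gt0 y0)) orbF => /eqP PQ.
apply/complex_mulmx_eq0; split; apply: possemidefmx_ker => //;
  rewrite -/p -/q; lra.
Qed.

(** Meant for [M = W^-1 T]: [coef_b] is the Rayleigh quotient of [M^T M], which gives its sign and,
    through its kernel, the case where it vanishes. *)
Lemma gram_possemidefmx (R : realType) (n : nat) (M : 'M[R]_n) :
  possemidefmx (M^T *m M).
Proof.
split=> [|v].
  by apply/is_hermitianmxP; rewrite expr0 scale1r !map_mx_id // trmx_mul trmxK.
by rewrite mulmxA -trmx_mul -mulmxA form1_ge0.
Qed.

Lemma gram_ker (R : realType) (n : nat) (M : 'M[R]_n) (v : 'cV[R]_n) :
  M^T *m M *m v = 0 -> M *m v = 0.
Proof.
move=> h; apply: form1_eq0.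
by rewrite trmx_mul -mulmxA [M^T *m _]mulmxA h mulmx0 mxE.
Qed.

Lemma complex_gram_ker (R : realType) (n : nat) (M : 'M[R]_n)
    (y : 'cV[R[i]]_n) :
  complexmx (M^T *m M) *m y = 0 -> complexmx M *m y = 0.
Proof.
by move=> /complex_mulmx_eq0[/gram_ker ? /gram_ker ?]; apply/complex_mulmx_eq0.
Qed.

(** * Scalar quadratics with nonpositive discriminant *)

Lemma norm_quadratic_root (R : realType) (A B D : R) (z : R[i]) :
  0 < A -> B ^+ 2 <= 4 * A * D ->
  A%:C * z ^+ 2 - B%:C * z + D%:C = 0 -> `|z| = (Num.sqrt (D / A))%:C.
Proof.
move=> A0 disc /eqP; rewrite eq_complex; case: z => s t /=.
move=> /andP[/eqP hr /eqP hi]; rewrite normc_def /=.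
have A_neq0 := lt0r_neq0 A0.
suff -> : D = A * (s ^+ 2 + t ^+ 2) by rewrite mulrAC divff // mul1r.
(* The imaginary part amounts to [t * (2 * A * s - B) = 0]. For a nonreal root it determines [B],
   and the real part then yields [D]. *)
have [t0 | t_neq0] := eqVneq t 0.
  move: hr; rewrite t0 => hr.
  have hD : D = B * s - A * s ^+ 2 by lra.
  (* At a real root this square equals the discriminant [B ^+ 2 - 4 * A * D], so the root is
     double. *)
  have : (2 * A * s - B) ^+ 2 = 0.
    apply/le_anti; rewrite sqr_ge0 andbT.
    by move: disc; rewrite hD; lra.
  by move=> /eqP; rewrite sqrf_eq0 => /eqP hB; rewrite hD; nra.
have hB : B = 2 * A * s by apply: (mulIf t_neq0); lra.
by move: hr; rewrite hB; lra.
Qed.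

Lemma discriminant_le (R : rcfType) (a b c alpha : R) :
  0 < a -> 0 < b -> 0 < alpha ->
  alpha <= 2 / b * (Num.sqrt (a * (a + c)) - a) ->
  (alpha * b) ^+ 2 <= 4 * a * (c - alpha * b).
Proof.
move=> a0 b0 alpha0; rewrite mulrAC ler_pdivlMr // => bnd.
set s := Num.sqrt _ in bnd.
have ab_gt0 : 0 < alpha * b by exact: mulr_gt0.
(* The bound now reads [alpha * b <= 2 * (s - a)], so [s > a > 0]. Since [Num.sqrt] is 0 on
   nonpositive arguments, [a * (a + c)] is positive and equals [s ^+ 2]. *)
have s_gt0 : 0 < s by lra.
have := s_gt0; rewrite sqrtr_gt0 => /ltW/sqr_sqrtr; rewrite -/s => sE.
have : (alpha * b + 2 * a) ^+ 2 <= (2 * s) ^+ 2.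
  by rewrite lerXn2r ?nnegrE //; lra.
rewrite exprMn sE; lra.
Qed.

(** * From the eigenvalue equation to the scalar quadratic *)

Lemma precmx_eigenpairE (R : realType) (n : nat) (W T : 'M[R]_n) (alpha : R)
    (l : R[i]) (x y : 'cV[R[i]]_n) : W \in unitmx ->
  eigenpair (precmx alpha W T) l (col_mx x y) ->
  - (complexmx T *m y) = (l - 1) *: (complexmx W *m x) /\
  complexmx T *m x - (alpha%:C * l) *: x = (l - 1) *: (complexmx W *m y).
Proof.
move=> uW [_ h].
have uG : Gmx alpha W \in unitmx.
  by rewrite unitmxE det_lblock unitrM -unitmxE uW.
have : complexmx (Amx W T) *m col_mx x y
    = l *: (complexmx (Gmx alpha W) *m col_mx x y).
  rewrite scalemxAr -h mulmxA /precmx /complexmx -map_mxM.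
  by rewrite mulKVmx.
rewrite /complexmx !map_block_mx map_mx0 map_scalar_mx /= map_mxN.
rewrite !mul_block_col mul0mx addr0 scale_col_mx mul_scalar_mx.
move=> /eq_col_mx; rewrite -!/(complexmx _) => -[h1 h2].
split; rewrite scalerBl scale1r.
  by rewrite -h1 mulNmx [in RHS]addrAC subrr add0r.
have -> : complexmx T *m x
    = l *: (alpha%:C *: x) + l *: (complexmx W *m y) - complexmx W *m y.
  by rewrite -scalerDr -h2 addrK.
by rewrite scalerA [alpha%:C * l]mulrC addrAC [X in X - _]addrAC subrr add0r.
Qed.

(** Multiplying the second equation by [mu] leaves [x] only in the product [mu *: x], which the
    first equation gives as [- V T y]. There is no division by [mu], so [mu = 0] is covered. *)
Lemma eliminate_quadratic (F : comPzRingType) (n : nat) (W V T : 'M[F]_n)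
    (z : 'rV[F]_n) (x y : 'cV[F]_n) (alpha mu : F) :
  V *m W = 1%:M -> - (T *m y) = mu *: (W *m x) ->
  T *m x - (alpha * (1 + mu)) *: x = mu *: (W *m y) ->
  (z *m T *m y) 0 0 * mu ^+ 2
    - alpha * (z *m (T *m (V *m V) *m T) *m y) 0 0 * mu
    + ((z *m (T *m V *m T *m V *m T) *m y) 0 0
       - alpha * (z *m (T *m (V *m V) *m T) *m y) 0 0) = 0.
Proof.
move=> VW e1 e2.
have mux : mu *: x = - (V *m T *m y).
  by rewrite -mulmxA -mulmxN e1 -scalemxAr mulmxA VW mul1mx.
have e3 : - (T *m V *m T *m y) + (alpha * (1 + mu)) *: (V *m T *m y)
    = mu ^+ 2 *: (W *m y).
  rewrite expr2 -[RHS]scalerA -e2 scalerBr [mu *: (T *m x)]scalemxAr mux.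
  rewrite scalerA [mu * _]mulrC -[(_ * mu) *: _]scalerA mux.
  by rewrite scalerN opprK mulmxN !mulmxA.
(* Pairing with [z T V] cancels [W] on the right and produces the three forms at once. *)
have := congr1 (fun u => (z *m T *m V *m u) 0 0) e3.
rewrite mulmxDr mulmxN -!scalemxAr !mulmxA -[_ *m V *m W]mulmxA VW mulmx1.
move: (z *m T *m y) => A.
move: (z *m T *m V *m V *m T *m y) => B.
move: (z *m T *m V *m T *m V *m T *m y) => C.
rewrite !mxE => e4.
have -> : A 0 0 * mu ^+ 2 - alpha * B 0 0 * mu + (C 0 0 - alpha * B 0 0)
  = mu ^+ 2 * A 0 0 - (- C 0 0 + alpha * (1 + mu) * B 0 0) by ring.
by rewrite e4 subrr.
Qed.

(** Normalizes by [N], the squared norm of [y]. With [N^-1 = 0] for [N = 0], the case [y = 0] gives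
    the trivial equation. *)
Lemma quadratic_divr (R : realType) (a b c alpha : R) (A B C N mu : R[i]) :
  a%:C = A / N -> b%:C = B / N -> c%:C = C / N ->
  A * mu ^+ 2 - alpha%:C * B * mu + (C - alpha%:C * B) = 0 ->
  a%:C * mu ^+ 2 - (alpha * b)%:C * mu + (c - alpha * b)%:C = 0.
Proof.
move=> aE bE cE e; rewrite rmorphB !rmorphM /= aE bE cE.
by rewrite -[RHS](mul0r N^-1) -e; ring.
Qed.

Lemma eigen_quadratic (R : realType) (n : nat) (W T : 'M[R]_n) (alpha : R)
    (l : R[i]) (x y : 'cV[R[i]]_n) :
  posdefmx W -> T \is symmetricmx ->
  eigenpair (precmx alpha W T) l (col_mx x y) ->
  (coef_a T y)%:C * (l - 1) ^+ 2 - (alpha * coef_b W T y)%:C * (l - 1)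
    + (coef_c W T y - alpha * coef_b W T y)%:C = 0.
Proof.
move=> pW symT; have uW := posdefmx_unit pW; have [symW _] := pW.
have [aE bE cE] := coef_abc_real y symW symT.
move=> /(precmx_eigenpairE uW) [e1 e2].
have VW : complexmx (invmx W) *m complexmx W = 1%:M.
  by rewrite /complexmx -map_mxM mulVmx ?map_mx1.
have lE : l = 1 + (l - 1) by rewrite addrC subrK.
rewrite {1}lE in e2.
have e := eliminate_quadratic (y^t*) VW e1 e2.
have TVVT : complexmx (T *m (invmx W *m invmx W) *m T) = complexmx T *m
    (complexmx (invmx W) *m complexmx (invmx W)) *m complexmx T.
  by rewrite /complexmx !map_mxM.
have TVTVT : complexmx (T *m invmx W *m T *m invmx W *m T) =
    complexmx T *m complexmx (invmx W) *m complexmx T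
    *m complexmx (invmx W) *m complexmx T.
  by rewrite /complexmx !map_mxM.
rewrite -TVVT -TVTVT in e.
exact: quadratic_divr aE bE cE e.
Qed.

Theorem theorem1 (R : realType) (n : nat) (W T : 'M[R]_n) (alpha : R)
    (m : nat) (lambda : 'I_m -> R[i]) (x y : 'I_m -> 'cV[R[i]]_n)
    (hW : posdefmx W) (hT : possemidefmx T) (halpha : 0 < alpha)
    (heig : forall k : 'I_m,
       eigenpair (precmx alpha W T) (lambda k) (col_mx (x k) (y k)))
    (hall : forall (l : R[i]) (u : 'cV[R[i]]_(n + n)),
       eigenpair (precmx alpha W T) l u -> exists k : 'I_m, lambda k = l)
    (hbound : forall k : 'I_m, y k != 0 -> coef_b W T (y k) != 0 ->
       alpha <= 2 / coef_b W T (y k) *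
         (Num.sqrt (coef_a T (y k) * (coef_a T (y k) + coef_c W T (y k)))
          - coef_a T (y k))) :
  forall k : 'I_m, `|lambda k - 1| <= (radius alpha W T (y k))%:C.
Proof.
move=> k; have uW := posdefmx_unit hW; have [/sym_trmx sW _] := hW.
have [symT _] := hT; have sT := sym_trmx symT.
have [xy0 _] := heig k; have [e1 e2] := precmx_eigenpairE uW (heig k).
have cWK z : complexmx (invmx W) *m (complexmx W *m z) = z.
  by rewrite mulmxA /complexmx -map_mxM mulVmx // map_mx1 mul1mx.
(* If mu <> 0, then T y = 0 would force x = 0 and then y = 0. *)
have Ty0_case : complexmx T *m y k = 0 -> lambda k - 1 = 0.
  move=> Ty0; apply/eqP; apply: contraNT xy0 => mu0.
  have W_inj z : (lambda k - 1) *: (complexmx W *m z) = 0 -> z = 0.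
    move=> /eqP; rewrite scaler_eq0 (negbTE mu0) => /eqP Wz0.
    by rewrite -(cWK _ z) Wz0 mulmx0.
  have x0 : x k = 0 by apply: W_inj; rewrite -e1 Ty0 oppr0.
  have y0 : y k = 0 by apply: W_inj; rewrite -e2 x0 mulmx0 scaler0 subr0.
  by rewrite x0 y0 col_mx0.
rewrite /radius; case: ifPn => [/orP[/eqP y0|a0] | ].
- by rewrite Ty0_case ?normr0 // y0 mulmx0.
- rewrite Ty0_case ?normr0 //.
  have [-> | y0] := eqVneq (y k) 0; first exact: mulmx0.
  exact: rquot_ker hT y0 (eqP a0).
rewrite negb_or => /andP[y0 a_neq0].
have a_gt0 : 0 < coef_a T (y k) by rewrite lt_def a_neq0 rquot_ge0.
have bE : coef_b W T (y k) = rquot ((invmx W *m T)^T *m (invmx W *m T)) (y k).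
  by rewrite /coef_b trmx_mul trmx_inv sW sT !mulmxA.
(* If [b] vanished, then [W^-1 T y = 0], hence [T y = 0] and [a = 0]. So the bound on [alpha] is
   available whenever [a] is nonzero. *)
have b_neq0 : coef_b W T (y k) != 0.
  apply: contraNneq a_neq0; rewrite bE => b0.
  have := complex_gram_ker (rquot_ker (gram_possemidefmx _) y0 b0).
  move=> /(congr1 (mulmx (complexmx W))); rewrite mulmx0 mulmxA /complexmx.
  rewrite -map_mxM mulKVmx // => Ty0.
  by rewrite /coef_a /rquot /hquot -mulmxA /complexmx Ty0 mulmx0 mxE mul0r.
have b_gt0 : 0 < coef_b W T (y k).
  by rewrite lt_def b_neq0 bE rquot_ge0 //; exact: gram_possemidefmx.
have := hbound k y0 b_neq0; have := eigen_quadratic hW symT (heig k).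
move: (coef_a _ _) (coef_b _ _ _) (coef_c _ _ _) a_gt0 b_gt0 => a b c a0 b0 q bnd.
(* Equality holds here: the eigenvalue lies on the circle itself. *)
by rewrite (norm_quadratic_root a0 _ q) //; exact: discriminant_le bnd.
Qed.
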